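(* Let $E$ be a Banach space, let $P\in\mathcal{L}(E)$ be a projector (i.e. $P^2=P$), and set $X:=\operatorname{ran}(P)$ and $Y:=\ker(P)$. Then $R_P=[P]$ if and only if the map $$\varphi_*\colon \pi_0\bigl(GL(X)\times GL(Y)\bigr)\to\pi_0\bigl(GL(E)\bigr)$$ induced on path-connected components by $$\varphi\colon GL(X)\times GL(Y)\to GL(E),\qquad \varphi(A,B):=A\oplus B,$$ is surjective.
   Context: For a Banach space $E$, $\mathcal{L}(E)$ is the Banach algebra of bounded linear operators on $E$ with the operator norm, and $GL(E)$ is the group of invertible elements of $\mathcal{L}(E)$ with the norm topology. $\mathcal{P}(\mathcal{L}(E)):=\{P\in\mathcal{L}(E) : P^2=P\}$ is the space of projectors, endowed with the subspace topology. For a topological space $Z$, $\pi_0(Z)$ is the set of path-connected components of $Z$, and $[z]$ is the path-connected component containing $z$; here $[P]$ denotes the path-connected component of $P$ in $\mathcal{P}(\mathcal{L}(E))$. The conjugacy class of $P$ is $R_P:=\{Q\in\mathcal{P}(\mathcal{L}(E)) : \exists\, T\in GL(E) \text{ such that } TP=QT\}$. Since $E=X\oplus Y$, for $A\in GL(X)$ and $B\in GL(Y)$ the operator $A\oplus B\in GL(E)$ is defined by $(A\oplus B)(x+y)=Ax+By$ for $x\in X$, $y\in Y$. *)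

(* Defs.v *)
From HB Require Import structures.
From mathcomp Require Import all_boot all_order all_algebra.
From mathcomp Require Import generic_quotient complex.
From mathcomp Require Import all_classical all_reals all_analysis.

Set Implicit Arguments.
Unset Strict Implicit.
Unset Printing Implicit Defensive.

Import Order.TTheory GRing.Theory Num.Theory.
Import numFieldNormedType.Exports.

Local Open Scope classical_set_scope.
Local Open Scope ring_scope.
Local Open Scope quotient_scope.

(* The scalar field of a Banach space is R or C. The norm of a module over K  *)
(* takes its values in K; for K = R[i] these are nonnegative, hence real, and *)
(* [scalar_re], [scalar_of] translate between R and the real elements of K.   *)
Variant scalar_kind := RealScalars | ComplexScalars.

Definition scalar_field (R : realType) (k : scalar_kind) : numFieldType :=
  match k with RealScalars => R | ComplexScalars => R[i] end.

Section scalars.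
Variables (R : realType) (k : scalar_kind).
Local Notation K := (scalar_field R k).

Definition scalar_re : K -> R :=
  match k return scalar_field R k -> R with
  | RealScalars => id
  | ComplexScalars => @complex.Re R
  end.

Definition scalar_of : R -> K :=
  match k return R -> scalar_field R k with
  | RealScalars => id
  | ComplexScalars => fun r => complex.Complex r 0
  end.

Lemma scalar_ofK (r : R) : scalar_re (scalar_of r) = r.
Proof. by rewrite /scalar_re /scalar_of; case: k. Qed.

Lemma scalar_reK (x : K) : 0 <= x -> scalar_of (scalar_re x) = x.
Proof.
rewrite /scalar_re /scalar_of; move: x; case: k => //= -[a b].
by rewrite lecE /= => /andP[/eqP -> _].
Qed.

Lemma le_scalar_re (x y : K) : x <= y -> scalar_re x <= scalar_re y.
Proof.
rewrite /scalar_re; move: x y; case: k => //= -[a b] [c d].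
by rewrite lecE /= => /andP[].
Qed.

Lemma le_scalar_of (r s : R) : r <= s -> scalar_of r <= scalar_of s.
Proof. by rewrite /scalar_of; case: k => //= rs; rewrite lecE /= eqxx. Qed.

End scalars.

Section bounded_operators.
Variables (R : realType) (k : scalar_kind).
Local Notation K := (scalar_field R k).
Variable E : normedModType K.

Definition bounded_linear : {pred E -> E} := [pred f : E -> E |
  `[< linear f /\ exists M : K, forall x, `|f x| <= M * `|x| >]].

Record bop := Bop { bop_fun :> E -> E ; _ : bop_fun \in bounded_linear }.

HB.instance Definition _ := [isSub for bop_fun].
HB.instance Definition _ := [Choice of bop by <:].

Lemma bounded_linear_submod_closed : submod_closed bounded_linear.
Proof.
split.
  apply/asboolP; split; first by move=> a x y; rewrite scaler0 addr0.
  by exists 0 => x; rewrite normr0 mul0r.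
move=> a f g /asboolP[lf [M Mf]] /asboolP[lg [N Ng]]; apply/asboolP; split.
  move=> b x y; rewrite !fctE /= lf lg !scalerDr !scalerA (mulrC a b).
  by rewrite addrACA.
exists (`|a| * M + N) => x; rewrite !fctE /=.
rewrite (le_trans (ler_normD _ _))// normrZ mulrDl lerD// -mulrA.
by rewrite ler_wpM2l.
Qed.

HB.instance Definition _ := GRing.isSubmodClosed.Build K (E -> E)
  bounded_linear bounded_linear_submod_closed.

HB.instance Definition _ := [SubChoice_isSubLmodule of bop by <:].

Lemma bop_linear (f : bop) : linear f.
Proof. by case: f => f /= /asboolP[]. Qed.

HB.instance Definition _ (f : bop) :=
  GRing.isLinear.Build K E E *:%R f (bop_linear f).

Lemma bop_bounded (f : bop) : exists M : K, forall x, `|f x| <= M * `|x|.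
Proof. by case: f => f /= /asboolP[]. Qed.

Lemma bopP (f g : bop) : (forall x, f x = g x) <-> f = g.
Proof. by split=> [fg|->//]; apply/val_inj/funext. Qed.

Definition opnorm (f : bop) : K :=
  scalar_of k (sup [set scalar_re `|f x| | x in [set x : E | `|x| <= 1]]).

Lemma opnorm_le (f : bop) (c : K) : 0 <= c ->
  (forall x, `|f x| <= c * `|x|) -> opnorm f <= c.
Proof.
move=> c0 fc; rewrite -(scalar_reK c0); apply: le_scalar_of; apply: ge_sup.
  by exists (scalar_re `|f 0|); exists 0 => //=; rewrite normr0.
move=> _ [x /= x1 <-]; apply: le_scalar_re; apply: le_trans (fc x) _.
by rewrite ler_piMr.
Qed.

Lemma le_opnorm1 (f : bop) (x : E) : `|x| <= 1 -> `|f x| <= opnorm f.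
Proof.
move=> x1; rewrite -(scalar_reK (normr_ge0 (f x))); apply: le_scalar_of.
apply: ub_le_sup; last by exists x.
have [M Mf] := bop_bounded f; exists (scalar_re `|M|) => _ [y /= y1 <-].
have [y0|y0] := eqVneq y 0.
  by rewrite y0 linear0 normr0; apply: le_scalar_re.
apply: le_scalar_re; apply: le_trans (Mf y) _.
have M0 : 0 <= M.
  have := le_trans (normr_ge0 _) (Mf y).
  by rewrite pmulr_lge0// normr_gt0.
by rewrite ger0_norm// ler_piMr.
Qed.

Lemma opnorm_ge0 (f : bop) : 0 <= opnorm f.
Proof. by have := @le_opnorm1 f 0; rewrite linear0 normr0; apply. Qed.

Lemma le_opnorm (f : bop) (x : E) : `|f x| <= opnorm f * `|x|.
Proof.
have [->|x0] := eqVneq x 0; first by rewrite linear0 !normr0 mulr0.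
have nx : 0 < `|x| by rewrite normr_gt0.
have := @le_opnorm1 f (`|x|^-1 *: x).
rewrite linearZ/= !normrZ normfV normr_id mulVf ?gt_eqF// => /(_ (lexx _)).
by rewrite ler_pdivrMl// mulrC.
Qed.

Lemma ler_opnormD (f g : bop) : opnorm (f + g) <= opnorm f + opnorm g.
Proof.
apply: opnorm_le => [|x]; first by rewrite addr_ge0 ?opnorm_ge0.
rewrite mulrDl [X in `|X|]/(f x + g x) (le_trans (ler_normD _ _))//.
by apply: lerD; apply: le_opnorm.
Qed.

Lemma opnormZ (a : K) (f : bop) : opnorm (a *: f) = `|a| * opnorm f.
Proof.
have leZ (b : K) (g : bop) : opnorm (b *: g) <= `|b| * opnorm g.
  apply: opnorm_le => [|x]; first by rewrite mulr_ge0 ?opnorm_ge0.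
  by rewrite [X in `|X|]/(b *: g x) normrZ -mulrA ler_wpM2l// le_opnorm.
have [->|a0] := eqVneq a 0.
  rewrite scale0r normr0 mul0r; apply/eqP; rewrite eq_le opnorm_ge0 andbT.
  by have := leZ 0 0; rewrite scale0r normr0 mul0r.
apply/eqP; rewrite eq_le leZ/= -ler_pdivlMl ?normr_gt0// -normfV.
by apply: le_trans (leZ _ _); rewrite scalerA mulVf// scale1r.
Qed.

Lemma opnorm_eq0 (f : bop) : opnorm f = 0 -> f = 0.
Proof.
move=> f0; apply/bopP => x; apply/eqP; rewrite -normr_le0.
by have := le_opnorm f x; rewrite f0 mul0r.
Qed.

HB.instance Definition _ := Lmodule_isNormed.Build K bop
  ler_opnormD opnormZ opnorm_eq0.

Lemma bop_id_subproof : (idfun : E -> E) \in bounded_linear.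
Proof. by apply/asboolP; split=> //; exists 1 => x; rewrite mul1r. Qed.

Definition bop_id : bop := Bop bop_id_subproof.

Lemma bop_comp_subproof (f g : bop) : (f \o g : E -> E) \in bounded_linear.
Proof.
apply/asboolP; split; first by move=> a x y /=; rewrite !linearP.
exists (opnorm f * opnorm g) => x /=; apply: le_trans (le_opnorm _ _) _.
by rewrite -mulrA ler_wpM2l ?opnorm_ge0 ?le_opnorm.
Qed.

Definition bop_comp (f g : bop) : bop := Bop (bop_comp_subproof f g).

Lemma bop_compA : associative bop_comp.
Proof. by move=> f g h; apply/bopP. Qed.

Lemma bop_comp1f : left_id bop_id bop_comp.
Proof. by move=> f; apply/bopP. Qed.

Lemma bop_compf1 : right_id bop_id bop_comp.
Proof. by move=> f; apply/bopP. Qed.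

Lemma bop_compDl : left_distributive bop_comp +%R.
Proof. by move=> f g h; apply/bopP. Qed.

Lemma bop_compDr : right_distributive bop_comp +%R.
Proof. by move=> f g h; apply/bopP => x; rewrite /= linearD. Qed.

HB.instance Definition _ := GRing.Zmodule_isPzRing.Build bop
  bop_compA bop_comp1f bop_compf1 bop_compDl bop_compDr.

End bounded_operators.

Notation "''L(' E )" := (bop E) (format "''L(' E )") : type_scope.

Section GL_projectors.
Variables (R : realType) (k : scalar_kind).
Variable E : normedModType (scalar_field R k).

Definition GL_set : set 'L(E) :=
  [set T | exists S : 'L(E), S * T = 1 /\ T * S = 1].

Definition GL : topologicalType := Topological.clone (set_type GL_set) _.

Definition GL_op (T : GL) : 'L(E) := sval T.

Definition projector_set : set 'L(E) := [set P | P * P = P].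

Definition projector : topologicalType :=
  Topological.clone (set_type projector_set) _.

Definition proj_op (P : projector) : 'L(E) := sval P.

Lemma proj_opK (P : projector) (x : E) : proj_op P (proj_op P x) = proj_op P x.
Proof.
have /set_mem PP : sval P \in projector_set := proj2_sig P.
exact: (congr1 (fun f : 'L(E) => f x) PP).
Qed.

Lemma GL_op_continuous : continuous GL_op.
Proof. exact: initial_continuous. Qed.

Lemma proj_op_continuous : continuous proj_op.
Proof. exact: initial_continuous. Qed.

End GL_projectors.
Arguments GL_set {R k} E.
Arguments projector_set {R k} E.

Section linear_subspaces.
Variables (R : realType) (k : scalar_kind).
Local Notation K := (scalar_field R k).
Variables (E : normedModType K) (S : submodClosed E).

Record lin_subspace := LinSubspace { lin_val :> E ; _ : lin_val \in S }.

HB.instance Definition _ := [isSub for lin_val].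
HB.instance Definition _ := [Choice of lin_subspace by <:].
HB.instance Definition _ := [SubChoice_isSubLmodule of lin_subspace by <:].

Definition lin_norm (x : lin_subspace) : K := `|lin_val x|.

Lemma ler_lin_normD x y : lin_norm (x + y) <= lin_norm x + lin_norm y.
Proof. exact: ler_normD. Qed.

Lemma lin_normZ a x : lin_norm (a *: x) = `|a| * lin_norm x.
Proof. exact: normrZ. Qed.

Lemma lin_val_inj : injective lin_val.
Proof. exact: val_inj. Qed.

Lemma lin_norm_eq0 x : lin_norm x = 0 -> x = 0.
Proof. by move/normr0_eq0 => x0; apply: val_inj. Qed.

HB.instance Definition _ := Lmodule_isNormed.Build K lin_subspace
  ler_lin_normD lin_normZ lin_norm_eq0.

End linear_subspaces.

Section range_kernel.
Variables (R : realType) (k : scalar_kind).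
Local Notation K := (scalar_field R k).
Variables (E : normedModType K) (f : 'L(E)).

Definition ran_pred : {pred E} := [pred y : E | y \in range f].
Definition ker_pred : {pred E} := [pred x : E | f x == 0].

Lemma ran_submod_closed : submod_closed ran_pred.
Proof.
split; first by rewrite !inE; exists 0 => //; rewrite linear0.
move=> a x y; rewrite !inE => -[u _ <-] [v _ <-].
by exists (a *: u + v) => //; rewrite linearP.
Qed.

Lemma ker_submod_closed : submod_closed ker_pred.
Proof.
split; first by rewrite inE linear0.
move=> a x y; rewrite !inE => /eqP fx0 /eqP fy0.
by rewrite bop_linear fx0 fy0 scaler0 addr0.
Qed.

HB.instance Definition _ := GRing.isSubmodClosed.Build K E
  ran_pred ran_submod_closed.
HB.instance Definition _ := GRing.isSubmodClosed.Build K E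
  ker_pred ker_submod_closed.

Definition ran : normedModType K := NormedModule.clone K
  (lin_subspace (GRing.SubmodClosed.clone K E ran_pred _)) _.
Definition ker : normedModType K := NormedModule.clone K
  (lin_subspace (GRing.SubmodClosed.clone K E ker_pred _)) _.

End range_kernel.

Section path_components.
Variable R : realType.

Definition path_connected (Z : topologicalType) (x y : Z) : Prop :=
  exists gamma : R -> Z,
    [/\ {within `[0, 1], continuous gamma}, gamma 0 = x & gamma 1 = y].

Lemma path_connected_refl (Z : topologicalType) (x : Z) : path_connected x x.
Proof.
exists (cst x); split => //.
by apply/continuous_subspaceT => t; exact: cvg_cst.
Qed.

Lemma path_connected_reparam (Z : topologicalType) (gamma : R -> Z)
    (h : R -> R) (A : set R) :
  {within `[0, 1], continuous gamma} -> continuous h ->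
  (forall t, A t -> 0 <= h t <= 1) -> {within A, continuous (gamma \o h)}.
Proof.
move=> cg ch hA; apply/subspace_continuousP => t At U gU.
have h01 : `[0, 1]%classic (h t) by rewrite /= in_itv /= hA.
have gU' : nbhs (h t) (fun v => `[0, 1]%classic v -> U (gamma v)).
  by move/subspace_continuousP : cg => /(_ _ h01 _ gU).
change (nbhs t (fun u => A u -> U (gamma (h u)))).
have : nbhs t (fun u => `[0, 1]%classic (h u) -> U (gamma (h u))).
  exact: (ch t _ gU').
apply: (@filterS _ (nbhs t)) => u hu Au; apply: hu => /=.
by rewrite in_itv /= hA.
Qed.

Lemma path_connected_sym (Z : topologicalType) (x y : Z) :
  path_connected x y -> path_connected y x.
Proof.
move=> [g [cg g0 g1]]; exists (g \o (fun t => 1 - t)); split => /=.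
- apply: path_connected_reparam => // [|t /=].
    by move=> t; apply: cvgB; [exact: cvg_cst|exact: cvg_id].
  by rewrite in_itv /= => /andP[t0 t1]; rewrite subr_ge0 t1 gerBl t0.
- by rewrite subr0.
- by rewrite subrr.
Qed.

Lemma path_connected_trans (Z : topologicalType) (y x z : Z) :
  path_connected x y -> path_connected y z -> path_connected x z.
Proof.
move=> [g [cg g0 g1]] [h [ch h0 h1]].
pose a (t : R) := 2 * t; pose b (t : R) := 2 * t - 1.
pose f t := if t <= 2^-1 then g (a t) else h (b t).
have ca : continuous a by move=> t; apply: cvgMr; exact: cvg_id.
have cb : continuous b by move=> t; apply: cvgB; [exact: ca|exact: cvg_cst].
exists f; split; last first.
- rewrite /f /b (_ : (1 <= 2^-1 :> R) = false) ?mulr1 ?addrK//.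
  by apply/negbTE; rewrite -ltNge invf_lt1 ?ltr1n.
- by rewrite /f /a invr_ge0 ler0n mulr0.
have half0 : 0 <= 2^-1 :> R by rewrite invr_ge0.
have half1 : 2^-1 <= 1 :> R by rewrite invf_le1 ?ler1n.
have -> : `[0, 1]%classic = `[0, 2^-1]%classic `|` `[2^-1, 1]%classic :> set R.
  apply/seteqP; split => t /=; rewrite !in_itv /=.
    move=> /andP[t0 t1]; rewrite t0 t1 andbT /=.
    by case: (leP t 2^-1) => [|/ltW] ?; [left|right].
  by move=> [/andP[t0 t1]|/andP[t0 t1]]; apply/andP; split=> //;
    [exact: le_trans t1 half1|exact: le_trans half0 t0].
apply: withinU_continuous; do ?exact: interval_closed.
- apply: (@subspace_eq_continuous _ _ _ (g \o a)).
    by move=> t /set_mem /=; rewrite in_itv /= /from_subspace /f => /andP[_ ->].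
  apply: path_connected_reparam => // t /=; rewrite in_itv /= => /andP[t0 t1].
  by rewrite /a mulr_ge0//= mulrC -ler_pdivlMr// div1r.
- apply: (@subspace_eq_continuous _ _ _ (h \o b)).
    move=> t /set_mem /=; rewrite in_itv /= /from_subspace /f => /andP[t1 _].
    case: (leP t 2^-1) => // t2.
    have -> : t = 2^-1 by apply/eqP; rewrite eq_le t1 t2.
    by rewrite /a /b divff// subrr g1 h0.
  apply: path_connected_reparam => // t /=; rewrite in_itv /= => /andP[t0 t1].
  rewrite /b subr_ge0 lerBlDr mulrC -ler_pdivrMr// div1r t0 /=.
  by rewrite -[leRHS]/(2 : R) -[leRHS]mul1r ler_wpM2r.
Qed.

Definition path_equivb (Z : topologicalType) (x y : Z) : bool :=
  `[< path_connected x y >].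

Lemma path_equivb_refl (Z : topologicalType) : reflexive (@path_equivb Z).
Proof. by move=> x; apply/asboolP; exact: path_connected_refl. Qed.

Lemma path_equivb_sym (Z : topologicalType) : symmetric (@path_equivb Z).
Proof.
by move=> x y; apply/idP/idP => /asboolP ?; apply/asboolP;
  exact: path_connected_sym.
Qed.

Lemma path_equivb_trans (Z : topologicalType) : transitive (@path_equivb Z).
Proof.
move=> y x z /asboolP xy /asboolP yz; apply/asboolP.
exact: path_connected_trans xy yz.
Qed.

Canonical path_equiv (Z : topologicalType) := EquivRel (@path_equivb Z)
  (@path_equivb_refl Z) (@path_equivb_sym Z) (@path_equivb_trans Z).

Definition pi0 (Z : topologicalType) := {eq_quot (path_equiv Z)}.

Definition path_component (Z : topologicalType) (z : Z) : set Z :=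
  [set w | path_connected z w].

Lemma pi0P (Z : topologicalType) (z w : Z) :
  \pi_(pi0 Z) z = \pi_(pi0 Z) w <-> path_connected z w.
Proof.
by split => [/eqmodP/asboolP//|zw]; apply/eqmodP; exact/asboolP.
Qed.

(* Independence of the representative, i.e. [z] |-> [f z], is [pi0_mapE].     *)
Definition pi0_map (Z W : topologicalType) (f : continuousType Z W)
    (c : pi0 Z) : pi0 W := \pi_(pi0 W) (f (repr c)).

Lemma pi0_mapE (Z W : topologicalType) (f : continuousType Z W) (z : Z) :
  pi0_map f (\pi_(pi0 Z) z) = \pi_(pi0 W) (f z).
Proof.
apply/pi0P; have /pi0P[g [cg g0 g1]] : \pi_(pi0 Z) (repr (\pi_(pi0 Z) z)) =
  \pi_(pi0 Z) z by rewrite reprK.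
exists (f \o g); rewrite /= g0 g1; split => //.
apply/subspace_continuousP => t t01.
move/subspace_continuousP : cg => /(_ _ t01) cgt.
by apply: cvg_trans (cvg_app f cgt) _; exact: cts_fun.
Qed.

End path_components.
Arguments pi0_map R {Z W} f c.

Section direct_sum.
Variables (R : realType) (k : scalar_kind).
Local Notation K := (scalar_field R k).
Variables (E : normedModType K) (P : projector E).

Local Notation p := (proj_op P).
Local Notation X := (ran p).
Local Notation Y := (ker p).

Lemma mem_ran x : p x \in ran_pred p.
Proof. by rewrite inE; exists x. Qed.

Lemma mem_ker x : x - p x \in ker_pred p.
Proof. by rewrite inE linearB /= proj_opK subrr. Qed.

Definition to_ran (x : E) : X := LinSubspace (mem_ran x).
Definition to_ker (x : E) : Y := LinSubspace (mem_ker x).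

(* The decomposition [e = x + y] of [e] along [E = X + Y] has [x = P e] and   *)
(* [y = e - P e].                                                             *)
Definition dsum_fun (A : 'L(X)) (B : 'L(Y)) (e : E) : E :=
  lin_val (A (to_ran e)) + lin_val (B (to_ker e)).

Lemma to_ranP a x y : to_ran (a *: x + y) = a *: to_ran x + to_ran y.
Proof. by apply: lin_val_inj; rewrite /= bop_linear. Qed.

Lemma to_kerP a x y : to_ker (a *: x + y) = a *: to_ker x + to_ker y.
Proof.
by apply: lin_val_inj; rewrite /= bop_linear opprD addrACA scalerBr.
Qed.

Lemma dsum_bound (A : 'L(X)) (B : 'L(Y)) (e : E) :
  `|dsum_fun A B e| <= (`|A| * `|p| + `|B| * `|1 - p|) * `|e|.
Proof.
apply: le_trans (ler_normD _ _) _; rewrite mulrDl -!mulrA.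
apply: lerD.
  by apply: le_trans (le_opnorm A _) _; apply: ler_wpM2l;
    [exact: opnorm_ge0|exact: (le_opnorm p e)].
apply: le_trans (le_opnorm B _) _; apply: ler_wpM2l.
  exact: opnorm_ge0.
exact: (le_opnorm (1 - p) e).
Qed.

Lemma dsum_subproof (A : 'L(X)) (B : 'L(Y)) :
  dsum_fun A B \in @bounded_linear R k E.
Proof.
apply/asboolP; split; last first.
  by exists (`|A| * `|p| + `|B| * `|1 - p|); exact: dsum_bound.
move=> a x y; rewrite /dsum_fun to_ranP to_kerP !bop_linear /= scalerDr.
by rewrite addrACA.
Qed.

Definition dsum (A : 'L(X)) (B : 'L(Y)) : 'L(E) := Bop (dsum_subproof A B).

Lemma to_ranD (x : X) (y : Y) : to_ran (lin_val x + lin_val y) = x.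
Proof.
apply: lin_val_inj => /=; case: x y => [x xP] [y yP] /=; rewrite linearD /=.
move: yP; rewrite inE => /eqP ->; rewrite addr0.
by move: xP; rewrite inE => -[z _ <-]; rewrite proj_opK.
Qed.

Lemma to_kerD (x : X) (y : Y) : to_ker (lin_val x + lin_val y) = y.
Proof.
apply: lin_val_inj => /=; rewrite -[p _]/(lin_val (to_ran _)) to_ranD.
by rewrite addrC addrA addNr add0r.
Qed.

Lemma dsumE (A : 'L(X)) (B : 'L(Y)) (x : X) (y : Y) :
  dsum A B (lin_val x + lin_val y) = lin_val (A x) + lin_val (B y).
Proof. by rewrite /= /dsum_fun to_ranD to_kerD. Qed.

Lemma dsumM (A A' : 'L(X)) (B B' : 'L(Y)) :
  dsum A B * dsum A' B' = dsum (A * A') (B * B').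
Proof. by apply/bopP => e; rewrite [LHS]dsumE. Qed.

Lemma dsum1 : dsum 1 1 = 1.
Proof. by apply/bopP => e; rewrite /= /dsum_fun /= addrC subrK. Qed.

Lemma dsumB (A A' : 'L(X)) (B B' : 'L(Y)) :
  dsum A B - dsum A' B' = dsum (A - A') (B - B').
Proof.
by apply/bopP => e; rewrite /= /dsum_fun /= [LHS]/(_ - _) opprD addrACA.
Qed.

Definition GL_prod : topologicalType :=
  Topological.clone (GL X * GL Y)%type _.

Lemma dsum_GL_subproof (v : GL_prod) :
  dsum (GL_op v.1) (GL_op v.2) \in GL_set E.
Proof.
case: v => -[A /set_mem[A' [A'A AA']]] [B /set_mem[B' [B'B BB']]] /=.
apply/mem_set; exists (dsum A' B').
by rewrite !dsumM A'A AA' B'B BB' dsum1.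
Qed.

Definition dsum_GL_fun (v : GL_prod) : GL E :=
  exist _ (dsum (GL_op v.1) (GL_op v.2)) (dsum_GL_subproof v).

Lemma dsum_GL_continuous : continuous dsum_GL_fun.
Proof.
suff cd : continuous (fun v : GL_prod => dsum (GL_op v.1) (GL_op v.2)).
  exact: continuous_comp_initial.
move=> v; apply/cvgrPdist_lt => e e0.
have c1 : GL_op w.1 @[w --> v] --> GL_op v.1.
  apply: (@continuous_comp _ _ _ fst (@GL_op _ _ X) v).
    exact: cvg_fst.
  exact: GL_op_continuous.
have c2 : GL_op w.2 @[w --> v] --> GL_op v.2.
  apply: (@continuous_comp _ _ _ snd (@GL_op _ _ Y) v).
    exact: cvg_snd.
  exact: GL_op_continuous.
have n1 : 0 < `|p| + 1 by rewrite ltr_wpDl.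
have n2 : 0 < `|1 - p| + 1 by rewrite ltr_wpDl.
near=> w; rewrite dsumB.
rewrite (@le_lt_trans _ _ (`|GL_op v.1 - GL_op w.1| * (`|p| + 1)
   + `|GL_op v.2 - GL_op w.2| * (`|1 - p| + 1)))//.
  apply: opnorm_le; first by rewrite addr_ge0// mulr_ge0// ltW.
  move=> x; apply: le_trans (dsum_bound _ _ _) _; apply: ler_wpM2r => //.
  by apply: lerD; apply: ler_wpM2l => //; rewrite lerDl.
rewrite (splitr e) ltrD// -ltr_pdivlMr//; near: w;
  apply: cvgr_dist_lt => //; by rewrite !divr_gt0.
Unshelve. all: by end_near. Qed.

HB.instance Definition _ :=
  isContinuous.Build GL_prod (GL E) dsum_GL_fun dsum_GL_continuous.

Definition dsum_GL : continuousType GL_prod (GL E) :=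
  Continuous.clone GL_prod (GL E) dsum_GL_fun _.

Definition conj_class : set (projector E) :=
  [set Q | exists T : GL E, GL_op T * proj_op P = proj_op Q * GL_op T].

End direct_sum.

(* Main.v *)
(* A projector Q close to P is intertwined with P, that is U P = Q U, by some *)
(* U close to 1, and the segment from 1 to U stays in GL(E) by the Neumann    *)
(* series. Being intertwined by an element of the path component of 1 is      *)
(* therefore an equivalence relation on projectors with open classes, so by   *)
(* connectedness of [0, 1] every path from P to Q yields such a U. In         *)
(* particular [P] is always included in R_P.                                  *)
(* If R_P = [P] and T is in GL(E), take U in the component of 1 that          *)
(* intertwines P and T P T^-1: then U^-1 T commutes with P, i.e. has the form *)
(* A (+) B, and it lies in the component of T. Conversely, if T is in the     *)
(* component of some A (+) B, conjugating P along a path joining them gives a *)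
(* path from P to T P T^-1.                                                   *)
Require Import Defs.
From HB Require Import structures.
From mathcomp Require Import all_boot all_order all_algebra.
From mathcomp Require Import generic_quotient complex.
From mathcomp Require Import all_classical all_reals all_analysis.

Set Implicit Arguments.
Unset Strict Implicit.
Unset Printing Implicit Defensive.

Import Order.TTheory GRing.Theory Num.Theory.
Import numFieldNormedType.Exports.

Local Open Scope classical_set_scope.
Local Open Scope ring_scope.
Local Open Scope quotient_scope.

(** * The embedding of the reals into the scalar field *)

Section scalars.
Variables (R : realType) (k : scalar_kind).
Local Notation K := (scalar_field R k).
Local Notation sc := (@scalar_of R k).

(** The key equivalence: [T] lies in the path component of some block-diagonal operator iff
    [T P T^-1] lies in [[P]]. A path of projectors yields an intertwiner in the component of [1]
    ([path_connected_isotopic]), because nearby projectors are intertwined by an operator near [1]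
    ([isotopic_near]), invertible by completeness of [E] ([neumann_GL]). The invertible operators
    commuting with [P] are exactly the block-diagonal ones ([GL_commute_dsum], [dsum_comm]). Letting
    [T] vary gives the theorem, as [[P]] is always contained in [conj_class P]. *)

Lemma scalar_of0 : sc 0 = 0. Proof. by rewrite /scalar_of; case: k. Qed.

Lemma scalar_of1 : sc 1 = 1. Proof. by rewrite /scalar_of; case: k. Qed.

Lemma scalar_ofB r s : sc (r - s) = sc r - sc s.
Proof.
by rewrite /scalar_of; case: k => //=; exact: (rmorphB (real_complex R)).
Qed.

Lemma scalar_ofX r n : sc (r ^+ n) = sc r ^+ n.
Proof.
by rewrite /scalar_of; case: k => //=; exact: (rmorphXn (real_complex R)).
Qed.

Lemma scalar_of_norm r : `|sc r| = sc `|r|.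
Proof.
wlog r0 : r / 0 <= r => [H|].
  have [|/ltW] := leP 0 r; first exact: H.
  rewrite -oppr_ge0 => /H; rewrite normrN => <-.
  by rewrite -[- r]add0r scalar_ofB scalar_of0 add0r normrN.
by rewrite !ger0_norm// -scalar_of0; apply: le_scalar_of.
Qed.

Lemma scalar_of_inj : injective sc.
Proof. exact: can_inj (@scalar_ofK R k). Qed.

Lemma lt_scalar_of r s : r < s -> sc r < sc s.
Proof.
by rewrite !lt_neqAle => /andP[rs /(le_scalar_of k) ->];
  rewrite (inj_eq scalar_of_inj) rs.
Qed.

Lemma scalar_re_gt0 (x : K) : 0 < x -> 0 < scalar_re x.
Proof.
move=> x0; have := scalar_reK (ltW x0).
have := le_scalar_re (ltW x0); rewrite -[X in scalar_re X]scalar_of0 scalar_ofK.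
rewrite le_eqVlt => /predU1P[<-|//] h.
by move: x0; rewrite -h scalar_of0 ltxx.
Qed.

Lemma scalar_of_continuous : continuous (sc : R -> K).
Proof.
move=> r; apply/cvgrPdist_lt => e e0; near=> s.
rewrite -scalar_ofB scalar_of_norm -(scalar_reK (ltW e0)).
apply: lt_scalar_of; near: s.
by apply: (@cvgr_dist_lt _ _ _ _ _ (fun s : R => s) r _ _ (scalar_re_gt0 e0));
  exact: cvg_id.
Unshelve. all: by end_near. Qed.

(** Norms are [K]-valued, so geometric decay is transferred from [R] through [scalar_re]. *)
Lemma scalar_expr_lt (c e : K) : 0 <= c -> c < 1 -> 0 < e ->
  exists n, c ^+ n < e.
Proof.
move=> c0 c1 e0; rewrite -(scalar_reK c0) -(scalar_reK (ltW e0)).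
have r1 : scalar_re c < 1.
  rewrite -(scalar_ofK k 1) scalar_of1 lt_neqAle le_scalar_re ?ltW// andbT.
  apply/negP => /eqP /(congr1 sc); rewrite !scalar_reK// => h.
  by rewrite h ltxx in c1.
have r0 : 0 <= scalar_re c by rewrite -(scalar_ofK k 0) scalar_of0 le_scalar_re.
have /cvg_expr : `|scalar_re c| < 1 by rewrite ger0_norm.
move=> /cvgrPdist_lt/(_ _ (scalar_re_gt0 e0))[N _ /(_ N (leqnn N))] /=.
rewrite sub0r normrN normrX ger0_norm// => h.
by exists N; rewrite -scalar_ofX; apply: lt_scalar_of.
Qed.

End scalars.

(** * The topology of [GL E] and conjugation of projectors *)

Section operators.
Variables (R : realType) (k : scalar_kind).
Local Notation K := (scalar_field R k).
Variable E : normedModType K.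

Lemma opnormM (f g : 'L(E)) : `|f * g| <= `|f| * `|g|.
Proof.
apply: opnorm_le => [|x]; first exact: mulr_ge0.
apply: le_trans (le_opnorm f (g x)) _; rewrite -mulrA.
by apply: ler_wpM2l; [exact: opnorm_ge0|exact: le_opnorm].
Qed.

(** Uses [a b - f g = (a - f) g + a (b - g)], with [g] eventually bounded by [|b| + 1]. *)
Lemma bop_mul_cvg T (F : set_system T) (FF : Filter F) (f g : T -> 'L(E))
    (a b : 'L(E)) :
  f @ F --> a -> g @ F --> b -> (f x * g x) @[x --> F] --> a * b.
Proof.
move=> fa gb; apply/cvgrPdist_lt => e e0.
have na : 0 < `|a| + 1 by rewrite ltr_wpDl.
have nb : 0 < `|b| + 1 by rewrite ltr_wpDl.
near=> x.
have -> : a * b - f x * g x = (a - f x) * g x + a * (b - g x).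
  by rewrite mulrBl mulrBr [RHS]addrC addrA subrK.
apply: le_lt_trans (ler_normD _ _) _.
apply: (@le_lt_trans _ _ (`|a - f x| * (`|b| + 1) + (`|a| + 1) * `|b - g x|)).
  apply: lerD; apply: le_trans (opnormM _ _) _.
    apply: ler_wpM2l => //.
    have -> : g x = b - (b - g x) by rewrite subKr.
    apply: le_trans (ler_normB _ _) _; rewrite lerD2l ltW//.
    by near: x; apply: cvgr_dist_lt.
  by apply: ler_wpM2r => //; rewrite lerDl.
rewrite (splitr e) ltrD//.
  rewrite -ltr_pdivlMr//; near: x.
  by apply: cvgr_dist_lt => //; rewrite !divr_gt0.
rewrite mulrC -ltr_pdivlMr//; near: x.
by apply: cvgr_dist_lt => //; rewrite !divr_gt0.
Unshelve. all: by end_near. Qed.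

Lemma bop_mul_continuous (Z : topologicalType) (f g : Z -> 'L(E)) :
  continuous f -> continuous g -> continuous (fun z => f z * g z).
Proof.
move=> cf cg z.
by apply: (@bop_mul_cvg Z (nbhs z) _ f g); [exact: cf|exact: cg].
Qed.

Lemma continuous_to_GL (Z : topologicalType) (f : Z -> GL E) :
  continuous (fun z => GL_op (f z)) -> continuous f.
Proof. exact: continuous_comp_initial. Qed.

Lemma continuous_to_projector (Z : topologicalType) (f : Z -> projector E) :
  continuous (fun z => proj_op (f z)) -> continuous f.
Proof. exact: continuous_comp_initial. Qed.

Lemma GL_mul_subproof (S T : GL E) : GL_op S * GL_op T \in GL_set E.
Proof.
have /set_mem[S' [S'S SS']] : GL_op S \in GL_set E := proj2_sig S.
have /set_mem[T' [T'T TT']] : GL_op T \in GL_set E := proj2_sig T.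
apply/mem_set; exists (T' * S') => /=; split.
  by rewrite mulrA -(mulrA T') S'S mulr1.
by rewrite mulrA -(mulrA (GL_op S)) TT' mulr1.
Qed.

Definition GL_mul (S T : GL E) : GL E :=
  exist _ (GL_op S * GL_op T) (GL_mul_subproof S T).

Lemma GL_one_subproof : (1 : 'L(E)) \in GL_set E.
Proof. by apply/mem_set; exists 1; rewrite mulr1. Qed.

Definition GL_one : GL E := exist _ 1 GL_one_subproof.

Lemma GL_has_inv (T : GL E) :
  exists S : GL E, GL_op S * GL_op T = 1 /\ GL_op T * GL_op S = 1.
Proof.
have /set_mem[S [ST TS]] : GL_op T \in GL_set E := proj2_sig T.
have SG : S \in GL_set E by apply/mem_set; exists (GL_op T).
by exists (exist _ S SG).
Qed.

Definition GL_inv (T : GL E) : GL E := projT1 (cid (GL_has_inv T)).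

Lemma GL_mulVT T : GL_op (GL_inv T) * GL_op T = 1.
Proof. by rewrite /GL_inv; case: cid => S []. Qed.

Lemma GL_mulTV T : GL_op T * GL_op (GL_inv T) = 1.
Proof. by rewrite /GL_inv; case: cid => S []. Qed.

Lemma GL_op_inj : injective (@GL_op _ _ E).
Proof. exact: val_inj. Qed.

Lemma GL_mul1 T : GL_mul GL_one T = T.
Proof. by apply: GL_op_inj; rewrite /= mul1r. Qed.

Lemma GL_mulV T : GL_mul T (GL_inv T) = GL_one.
Proof. by apply: GL_op_inj; rewrite /= GL_mulTV. Qed.

Lemma GL_inv_intertwine (U : GL E) (a b : 'L(E)) :
  GL_op U * a = b * GL_op U ->
  GL_op (GL_inv U) * b = a * GL_op (GL_inv U).
Proof.
move=> Uab; rewrite -[LHS]mulr1 -(GL_mulTV U) !mulrA -(mulrA _ b) -Uab.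
by rewrite mulrA GL_mulVT mul1r.
Qed.

(** Right translation by [S] turns a path from [1] to [U] into one from [S] to [U S]; all products
    of paths below arise this way. *)
Lemma GL_mulr_continuous (S : GL E) : continuous (GL_mul^~ S).
Proof.
apply: continuous_to_GL.
apply: (bop_mul_continuous (@GL_op_continuous R k E)).
exact: cst_continuous.
Qed.

(* If |f y - f z| |g z| <= 1/2, then |g y| <= 2 |g z|, because                *)
(* g z - g y = g y (f y - f z) g z.                                           *)
Lemma bop_inv_continuous (Z : topologicalType) (f g : Z -> 'L(E)) :
  (forall z, f z * g z = 1) -> (forall z, g z * f z = 1) ->
  continuous f -> continuous g.
Proof.
move=> fg gf cf z; apply/cvgrPdist_lt => e e0.
set c := `|g z| + 1.
have c0 : 0 < c by rewrite ltr_wpDl.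
have gz : `|g z| <= c by rewrite /c lerDl.
near=> y.
have dE : g z - g y = g y * (f y - f z) * g z.
  by rewrite mulrBr mulrBl gf mul1r -mulrA fg mulr1.
set n := `|g y|; set d := `|f z - f y|.
have dle : `|g z - g y| <= n * d * c.
  rewrite dE; apply: le_trans (opnormM _ _) _; apply: ler_pM => //.
  by apply: le_trans (opnormM _ _) _; rewrite /n /d (distrC (f y)).
have d1 : d * c <= 2^-1.
  rewrite -ler_pdivlMr// ltW// /d; near: y.
  by apply: cvgr_dist_lt; [exact: cf|rewrite divr_gt0].
have nle : n <= 2 * c.
  have : n <= c + n * 2^-1.
    have {1}-> : n = `|g z - (g z - g y)| by rewrite subKr.
    apply: le_trans (ler_normB _ _) _; apply: lerD => //.
    by apply: le_trans dle _; rewrite -mulrA ler_wpM2l ?normr_ge0.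
  by rewrite -lerBlDr {1}(splitr n) addrK ler_pdivrMr// mulrC.
apply: le_lt_trans dle _.
apply: (@le_lt_trans _ _ (2 * c * d * c)).
  by rewrite ler_pM2r// ler_wpM2r ?normr_ge0.
rewrite mulrAC mulrC -ltr_pdivlMr ?mulr_gt0// /d; near: y.
by apply: cvgr_dist_lt; [exact: cf|rewrite divr_gt0 ?mulr_gt0].
Unshelve. all: by end_near. Qed.

Lemma GL_inv_op_continuous : continuous (fun T : GL E => GL_op (GL_inv T)).
Proof.
exact: (bop_inv_continuous GL_mulTV GL_mulVT (@GL_op_continuous R k E)).
Qed.

Lemma conj_projector_subproof (P : projector E) (T : GL E) :
  GL_op T * proj_op P * GL_op (GL_inv T) \in projector_set E.
Proof.
have /set_mem PP : proj_op P \in projector_set E := proj2_sig P.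
apply/mem_set; rewrite /projector_set/= !mulrA -(mulrA _ (GL_op (GL_inv T))).
by rewrite GL_mulVT mulr1 -(mulrA _ _ (proj_op P)) PP.
Qed.

Definition conj_projector (P : projector E) (T : GL E) : projector E :=
  
  exist _ (GL_op T * proj_op P * GL_op (GL_inv T))
    (conj_projector_subproof P T).

Lemma conj_projector_continuous P : continuous (conj_projector P).
Proof.
apply: continuous_to_projector.
apply: bop_mul_continuous GL_inv_op_continuous.
apply: (bop_mul_continuous (@GL_op_continuous R k E)).
exact: cst_continuous.
Qed.

(** Passes between the intertwining relation of [conj_class] and a formula continuous in [T]. *)
Lemma conj_projectorP (P Q : projector E) (T : GL E) :
  GL_op T * proj_op P = proj_op Q * GL_op T <-> conj_projector P T = Q.
Proof.
split=> [TP|<- /=]; last by rewrite -mulrA GL_mulVT mulr1.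
by apply: val_inj; rewrite /= TP -mulrA GL_mulTV mulr1.
Qed.

End operators.

Lemma path_connected_map (R : realType) (Z W : topologicalType) (f : Z -> W)
    (x y : Z) :
  continuous f -> path_connected R x y -> path_connected R (f x) (f y).
Proof.
move=> cf [g [cg g0 g1]]; exists (f \o g); rewrite /= g0 g1; split => //.
apply/subspace_continuousP => t t01.
move/subspace_continuousP : cg => /(_ _ t01) cgt.
by apply: cvg_trans (cvg_app f cgt) _; exact: cf.
Qed.

(** * Invertibility of [1 + H] for [|H| < 1] *)

Section neumann.
Variables (R : realType) (k : scalar_kind).
Local Notation K := (scalar_field R k).
Variables (E : completeNormedModType K) (H : 'L(E)).
Hypothesis H1 : `|H| < 1.

(** Yields both injectivity of [1 + H] and boundedness of its inverse. *)
Lemma neumann_lower_bound (x : E) : (1 - `|H|) * `|x| <= `|x + H x|.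
Proof.
rewrite mulrBl mul1r lerBlDr -{1}(addrK (H x) x).
by apply: le_trans (ler_normB _ _) _; rewrite lerD2l; exact: le_opnorm.
Qed.

Let sub_gt0 : 0 < 1 - `|H|. Proof. by rewrite subr_gt0. Qed.

Lemma neumann_inj (x y : E) : x + H x = y + H y -> x = y.
Proof.
move=> xy; apply/eqP; rewrite -subr_eq0 -normr_le0.
rewrite -(pmulr_rle0 _ sub_gt0); apply: le_trans (neumann_lower_bound _) _.
by rewrite linearB/= addrACA xy -opprD subrr normr0.
Qed.

(** Fixed points of [x |-> y - H x] solve [x + H x = y]; the iterates are the partial sums of the
    Neumann series at [y]. *)
Let iterate (y : E) n := iter n (fun x => y - H x) 0.

Lemma iterate_bound y n : `|iterate y n| <= `|y| / (1 - `|H|).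
Proof.
elim: n => [|n IH] /=; first by rewrite normr0 divr_ge0// ltW.
(* Since [|y| + |H| q = q], the iteration preserves the ball of radius [q]. *)
set q := _ / _ in IH *; have yE : `|y| = q * (1 - `|H|).
  by rewrite divfK ?lt0r_neq0.
apply: le_trans (ler_normB _ _) _; rewrite {1}yE mulrBr mulr1.
rewrite -addrA gerDl addrC subr_le0 mulrC.
apply: le_trans (le_opnorm _ _) _.
by apply: ler_wpM2l; [exact: opnorm_ge0|exact: IH].
Qed.

(** The iteration contracts by [|H|], so [n] steps shrink the distance from [0] to the [j]-th
    iterate, uniformly in [j]. *)
Lemma iterate_dist y n j :
  `|iterate y n - iterate y (n + j)| <= `|H| ^+ n * (`|y| / (1 - `|H|)).
Proof.
elim: n => [|n IH].
  by rewrite add0n /= sub0r normrN mul1r; exact: iterate_bound.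
rewrite addSn /= opprB addrC addrA subrK -linearB/=.
apply: le_trans (le_opnorm _ _) _; rewrite exprS -mulrA.
by apply: ler_wpM2l; [exact: opnorm_ge0|rewrite distrC].
Qed.

Lemma neumann_surj (y : E) : exists x, x + H x = y.
Proof.
(* The added [1] keeps [C] positive when [y = 0], so that [e / C] is a valid tolerance. *)
set C := `|y| / (1 - `|H|) + 1.
have C0 : 0 < C by rewrite ltr_wpDl// divr_ge0// ltW.
have : cauchy (iterate y @ \oo).
  apply: cauchy_exP => e e0.
  have [N Ne] := scalar_expr_lt (normr_ge0 H) H1 (divr_gt0 e0 C0).
  exists (iterate y N); exists N => // n /= /subnKC <-.
  rewrite -ball_normE /=; apply: le_lt_trans (iterate_dist _ _ _) _.
  apply: (@le_lt_trans _ _ (`|H| ^+ N * C)).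
    by rewrite ler_wpM2l ?exprn_ge0// lerDl.
  by rewrite -ltr_pdivlMr.
move/cauchy_cvgP/cvg_ex => [x ux]; exists x.
suff : iterate y n.+1 @[n --> \oo] --> y - H x.
  have : iterate y n.+1 @[n --> \oo] --> x by rewrite (cvg_shiftS (iterate y)).
  move=> /(cvg_unique (@norm_hausdorff _ _)) h /h xE.
  by rewrite {1}xE subrK.
apply: cvgB; first exact: cvg_cst.
apply/cvgrPdist_lt => e e0; near=> n.
rewrite -linearB/=; apply: le_lt_trans (le_opnorm _ _) _.
apply: (@le_lt_trans _ _ `|x - iterate y n|).
  by rewrite ler_piMl// ltW.
by near: n; apply: cvgr_dist_lt.
Unshelve. all: by end_near. Qed.

Lemma neumann_GL : 1 + H \in GL_set E.
Proof.
have [s sK] := choice neumann_surj.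
have sb : s \in @bounded_linear R k E.
  apply/asboolP; split=> [a x y|].
    apply: neumann_inj; rewrite sK linearP/= addrACA -scalerDr.
    by rewrite !sK.
  exists (1 - `|H|)^-1 => y; rewrite ler_pdivlMl//.
  by apply: le_trans (neumann_lower_bound _) _; rewrite sK.
apply/mem_set; exists (Bop sb); split; apply/bopP => x /=.
  by apply: neumann_inj; rewrite sK.
exact: sK.
Qed.

End neumann.

(** * Lifting paths of projectors to intertwiners *)

Section projector_paths.
Variables (R : realType) (k : scalar_kind).
Local Notation K := (scalar_field R k).
Variable E : completeNormedModType K.

Lemma near_one_path_connected (T : GL E) :
  `|GL_op T - 1| < 1 -> path_connected R (GL_one E) T.
Proof.
set H := GL_op T - 1 => H1.
(* Clamping [t] to [[0, 1]] makes [1 + c t H] invertible for every real [t], as the type of [f]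
   demands. *)
pose c (t : R) : R := Num.max 0 (Num.min t 1).
have c01 t : 0 <= c t <= 1.
  by rewrite /c le_max lexx ge_max ler01 ge_min lexx orbT.
have cH t : `|scalar_of k (c t) *: H| < 1.
  have /andP[c0 c1] := c01 t.
  rewrite normrZ scalar_of_norm ger0_norm//; apply: le_lt_trans H1.
  by rewrite ler_piMl// -[leRHS](scalar_of1 R k); apply: le_scalar_of.
have cc : continuous c.
  move=> t; apply: (@continuous_max R R (cst 0) (id \min cst 1)).
    exact: cvg_cst.
  by apply: (@continuous_min R R id (cst 1)); [exact: cvg_id|exact: cvg_cst].
pose f t : GL E := exist _ (1 + scalar_of k (c t) *: H) (neumann_GL (cH t)).
have cf : continuous f.
  apply: continuous_to_GL => t /=; apply: cvgD; first exact: cvg_cst.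
  apply: cvgZl; apply: (continuous_comp (cc t)).
  exact: scalar_of_continuous.
exists f; split; first exact: continuous_subspaceT.
- apply: GL_op_inj; rewrite /= /c minEle ler01 maxxx.
  by rewrite scalar_of0 scale0r addr0.
- apply: GL_op_inj; rewrite /= /c minxx max_r ?ler01// scalar_of1 scale1r.
  by rewrite /H addrC subrK.
Qed.

Definition isotopic (P Q : projector E) : Prop := exists2 U : GL E,
  path_connected R (GL_one E) U & GL_op U * proj_op P = proj_op Q * GL_op U.

Lemma isotopic_refl P : isotopic P P.
Proof.
by exists (GL_one E); [exact: path_connected_refl|rewrite /= mul1r mulr1].
Qed.

Lemma isotopic_trans P Q S : isotopic P Q -> isotopic Q S -> isotopic P S.
Proof.
move=> [U pU UE] [V pV VE]; exists (GL_mul V U); last first.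
  by rewrite /= -mulrA UE mulrA VE mulrA.
apply: (path_connected_trans pU); rewrite -{1}(GL_mul1 U).
by apply: (path_connected_map (@GL_mulr_continuous R k E U)).
Qed.

Lemma isotopic_sym P Q : isotopic P Q -> isotopic Q P.
Proof.
move=> [U pU UE]; exists (GL_inv U).
  apply: path_connected_sym; rewrite -(GL_mulV U) -{1}(GL_mul1 (GL_inv U)).
  by apply: (path_connected_map (@GL_mulr_continuous R k E (GL_inv U))).
exact: GL_inv_intertwine.
Qed.

(* Witnessed by U = Q P + (1 - Q) (1 - P) = 1 + (Q - P) (2 P - 1).            *)
Lemma isotopic_near (P Q : projector E) :
  `|proj_op Q - proj_op P| * `|proj_op P *+ 2 - 1| < 1 -> isotopic P Q.
Proof.
set p := proj_op P; set q := proj_op Q => pq.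
have pp : p * p = p by have /set_mem := proj2_sig P.
have qq : q * q = q by have /set_mem := proj2_sig Q.
have H1 : `|(q - p) * (p *+ 2 - 1)| < 1.
  by apply: le_lt_trans pq; exact: opnormM.
pose U : GL E := exist _ (1 + (q - p) * (p *+ 2 - 1)) (neumann_GL H1).
exists U.
  by apply: near_one_path_connected; rewrite /= [1 + _]addrC addrK.
have pl : (p *+ 2 - 1) * p = p by rewrite mulrBl mul1r mulrnAl pp mulr2n addrK.
have pr : p * (p *+ 2 - 1) = p by rewrite mulrBr mulr1 mulrnAr pp mulr2n addrK.
(* Both [U P] and [Q U] reduce to [Q P]. *)
rewrite -/p -/q; transitivity (q * p); rewrite /=.
  by rewrite mulrDl mul1r -mulrA pl mulrBl pp addrC subrK.
rewrite mulrDr mulr1 mulrA [q * (q - p)]mulrBr qq [(q - _) * _]mulrBl.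
rewrite -[q * p * _]mulrA pr.
by rewrite mulrBr mulr1 mulrnAr mulr2n addrAC addrK [RHS]addrC subrK.
Qed.

Lemma isotopic_open P : open [set Q | isotopic P Q].
Proof.
rewrite openE => Q PQ; rewrite /interior.
set c := `|proj_op Q *+ 2 - 1| + 1.
have c0 : 0 < c by rewrite ltr_wpDl.
have : \forall S \near Q, `|proj_op Q - proj_op S| < c^-1.
  have /cvgrPdist_lt := @proj_op_continuous R k E Q.
  by apply; rewrite invr_gt0.
apply: filterS => S QS; apply: isotopic_trans PQ _; apply: isotopic_near.
rewrite distrC; apply: (@le_lt_trans _ _ (`|proj_op Q - proj_op S| * c)).
  by rewrite ler_wpM2l// lerDl.
by rewrite -ltr_pdivlMr// div1r.
Qed.

(** The class of [P] is open, and closed because its complement is a union of other open classes;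
    hence it contains the connected image of any path that starts at [P]. *)
Lemma path_connected_isotopic (P Q : projector E) :
  path_connected R P Q -> isotopic P Q.
Proof.
move=> [g [cg g0 g1]].
have co := connected_continuous_connected (@segment_connected R 0 1) cg.
have g0I : (g @` `[0, 1]%classic) P.
  by exists 0; rewrite //= in_itv/= lexx ler01.
have g1I : (g @` `[0, 1]%classic) Q.
  by exists 1; rewrite //= in_itv/= lexx ler01.
have /= := co (g @` `[0, 1]%classic `&` [set Q | isotopic P Q]).
move=> /(_ (ex_intro _ P (conj g0I (isotopic_refl P)))).
move=> /(_ (ex_intro2 _ _ _ (@isotopic_open P) erefl)) h.
suff : (g @` `[0, 1]%classic `&` [set Q | isotopic P Q]) Q by case.
rewrite h//; exists [set Q | isotopic P Q] => //.
rewrite -[X in closed X]setCK; apply: open_closedC.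
rewrite (_ : ~` _ =
  \bigcup_(S in [set S | ~ isotopic P S]) [set V | isotopic S V]).
  by apply: bigcup_open => S _; exact: isotopic_open.
apply/seteqP; split => [S PS|V [S /= PS SV] PV].
  by exists S => //; exact: isotopic_refl.
by apply: PS; apply: isotopic_trans PV _; exact: isotopic_sym.
Qed.

End projector_paths.

(** * Block decomposition of operators commuting with [P] *)

Section corners.
Variables (R : realType) (k : scalar_kind).
Local Notation K := (scalar_field R k).
Variables (E : normedModType K) (P : projector E).
Local Notation p := (proj_op P).
Local Notation X := (ran p).
Local Notation Y := (ker p).

Lemma proj_op_ran (x : X) : p (lin_val x) = lin_val x.
Proof. by case: x => x /=; rewrite inE => -[z _ <-]; rewrite proj_opK. Qed.

Lemma proj_op_ker (y : Y) : p (lin_val y) = 0.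
Proof. by case: y => y /=; rewrite inE => /eqP. Qed.

(** Projecting back with [to_ran] defines the corner for every [S]; it is the restriction to [X]
    when [S] commutes with [P]. *)
Lemma ran_corner_subproof (S : 'L(E)) :
  (fun x : X => to_ran P (S (lin_val x))) \in @bounded_linear R k X.
Proof.
apply/asboolP; split=> [a x y|].
  by rewrite -to_ranP; congr to_ran; rewrite -bop_linear.
exists (`|p| * `|S|) => x; apply: le_trans (le_opnorm p _) _.
by rewrite -mulrA; apply: ler_wpM2l; [exact: opnorm_ge0|exact: le_opnorm].
Qed.

Definition ran_corner (S : 'L(E)) : 'L(X) := Bop (ran_corner_subproof S).

Lemma ker_corner_subproof (S : 'L(E)) :
  (fun y : Y => to_ker P (S (lin_val y))) \in @bounded_linear R k Y.
Proof.
apply/asboolP; split=> [a x y|].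
  by rewrite -to_kerP; congr to_ker; rewrite -bop_linear.
exists (`|1 - p| * `|S|) => x; apply: le_trans (le_opnorm (1 - p) _) _.
by rewrite -mulrA; apply: ler_wpM2l; [exact: opnorm_ge0|exact: le_opnorm].
Qed.

Definition ker_corner (S : 'L(E)) : 'L(Y) := Bop (ker_corner_subproof S).

Lemma ran_corner1 : ran_corner 1 = 1.
Proof. by apply/bopP => x; apply: lin_val_inj; rewrite /= proj_op_ran. Qed.

Lemma ker_corner1 : ker_corner 1 = 1.
Proof.
by apply/bopP => y; apply: lin_val_inj; rewrite /= proj_op_ker subr0.
Qed.

Lemma bop_commE (S T : 'L(E)) x : S * T = T * S -> S (T x) = T (S x).
Proof. exact: (congr1 (fun f : 'L(E) => f x)). Qed.

Lemma ran_cornerM S T : T * p = p * T ->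
  ran_corner (S * T) = ran_corner S * ran_corner T.
Proof.
move=> Tp; apply/bopP => x; apply: lin_val_inj => /=.
by rewrite -(bop_commE _ Tp) proj_op_ran.
Qed.

Lemma ker_cornerM S T : T * p = p * T ->
  ker_corner (S * T) = ker_corner S * ker_corner T.
Proof.
move=> Tp; apply/bopP => y; apply: lin_val_inj => /=.
by rewrite -(bop_commE _ Tp) proj_op_ker linear0 subr0.
Qed.

Lemma dsum_corners S : S * p = p * S -> dsum (ran_corner S) (ker_corner S) = S.
Proof.
move=> Sp; apply/bopP => x; rewrite /= /dsum_fun /=.
rewrite -!(bop_commE _ Sp) proj_opK -[p (x - p x)]/(p (lin_val (to_ker P x))).
by rewrite proj_op_ker linear0 subr0 linearB/= addrC subrK.
Qed.

Lemma dsum10 : @dsum _ _ _ P 1 0 = p.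
Proof. by apply/bopP => x; rewrite /= /dsum_fun /= addr0. Qed.

(** [P] is itself the block operator with blocks [1] and [0], and these commute with [A] and [B]. *)
Lemma dsum_comm (A : 'L(X)) (B : 'L(Y)) : dsum A B * p = p * dsum A B.
Proof.
have h : dsum (A * 1) (B * 0) = dsum (1 * A) (0 * B).
  by rewrite mulr1 mul1r mulr0 mul0r.
rewrite -dsum10; transitivity (dsum (A * 1) (B * 0)).
  exact: (dsumM A 1 B 0).
rewrite h; apply: esym; exact: (dsumM 1 A 0 B).
Qed.

(** The inverse of [T] commutes with [P] too, so its corners invert those of [T]. *)
Lemma GL_commute_dsum (T : GL E) : GL_op T * p = p * GL_op T ->
  exists v : GL_prod P, dsum_GL P v = T.
Proof.
move=> Tp; set T' := GL_inv T.
have T'p : GL_op T' * p = p * GL_op T' by exact: GL_inv_intertwine.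
have AG : ran_corner (GL_op T) \in GL_set X.
  apply/mem_set; exists (ran_corner (GL_op T')).
  by rewrite -!ran_cornerM// GL_mulVT GL_mulTV ran_corner1.
have BG : ker_corner (GL_op T) \in GL_set Y.
  apply/mem_set; exists (ker_corner (GL_op T')).
  by rewrite -!ker_cornerM// GL_mulVT GL_mulTV ker_corner1.
exists (exist _ (ran_corner (GL_op T)) AG, exist _ (ker_corner (GL_op T)) BG).
by apply: GL_op_inj; exact: dsum_corners.
Qed.

End corners.

Theorem proposition2p1 (R : realType) (k : scalar_kind)
    (E : completeNormedModType (scalar_field R k)) (P : projector E) :
  conj_class P = path_component R P <->
  set_surj [set: pi0 R (GL_prod P)] [set: pi0 R (GL E)]
    (pi0_map R (dsum_GL P)).
Proof.
split=> [RP c _|surj].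
  set T : GL E := repr c.
  have [U pU UE] : isotopic P (conj_projector P T).
    apply: path_connected_isotopic.
    suff : conj_class P (conj_projector P T) by rewrite RP.
    by exists T; apply/conj_projectorP.
  (* [T] carries [P] to [T P T^-1] and [U^-1] carries it back, so [U^-1 T] commutes with [P]. *)
  have [|v vE] := @GL_commute_dsum _ _ _ P (GL_mul (GL_inv U) T).
    have /conj_projectorP TP := erefl (conj_projector P T).
    by rewrite [GL_op _]/= -mulrA TP mulrA (GL_inv_intertwine UE) mulrA.
  exists (\pi_(pi0 R (GL_prod P)) v) => //.
  rewrite pi0_mapE vE -[RHS]reprK; apply/pi0P.
  (* The path from [1] to [U], translated by [U^-1 T], runs from [U^-1 T] to [T]. *)
  have := path_connected_map
    (@GL_mulr_continuous _ _ _ (GL_mul (GL_inv U) T)) pU.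
  rewrite GL_mul1; congr path_connected.
  by apply: GL_op_inj; rewrite /= mulrA GL_mulTV mul1r.
apply/seteqP; split=> [Q [T /conj_projectorP <-]|Q].
  have [c _ /pi0P vT] := surj (\pi_(pi0 R (GL E)) T) I.
  (* Conjugating [P] along the path from the block operator to [T] starts at [P], which that
     operator fixes, and ends at [Q]. *)
  have := path_connected_map (@conj_projector_continuous _ _ _ P) vT.
  suff -> : conj_projector P (dsum_GL P (repr c)) = P by [].
  by apply/conj_projectorP; exact: dsum_comm.
by move=> /path_connected_isotopic [U _ UE]; exists U.
Qed.
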